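(* Let $\mathbb{R}^2_\pm=\{(x,z)\in\mathbb{R}^2 : \pm x>0\}$, $\mathbf e_x=(1,0)$, $\mathbf e_z=(0,1)$. Let $\mathbb{A}^\pm\in C^0(\mathbb{R}^2;\mathbb{R}^{2\times2})$, $\rho^\pm\in C^0(\mathbb{R}^2)$, and let $\mathbb{A}$, $\rho$ be the functions equal to $\mathbb{A}^\pm$, $\rho^\pm$ on $\mathbb{R}^2_\pm$. Assume one of the following: (A) there are $p^\pm_z>0$ such that $\mathbb{A}^\pm$ and $\rho^\pm$ are invariant under translation by $\mathbf e_x$ and by $p_z^\pm\mathbf e_z$; in this case set $\theta_1:=1/p_z^+$ and $\theta_2:=1/p_z^-$; (B) $\mathbb{A}^-$, $\rho^-$ are constant, and there is $\mathbf p^+=(p_x^+,p_z^+)\in\mathbb{R}^2$ with $p_z^+\ne0$ such that $\mathbb{A}^+$, $\rho^+$ are invariant under translation by $\mathbf e_x$ and by $\mathbf p^+$; in this case set $\theta_1:=1/p_z^+$ and $\theta_2:=-p_x^+/p_z^+$. Then there exist $\mathbb{Z}^3$-periodic functions $\mathbb{A}_p^\pm\in C^0(\mathbb{R}^3;\mathbb{R}^{2\times 2})$ and $\rho_p^\pm\in C^0(\mathbb{R}^3)$ such that, if $\mathbb{A}_p$, $\rho_p$ denote the functions equal to $\mathbb{A}_p^\pm$, $\rho_p^\pm$ on $\{(x,z_1,z_2)\in\mathbb{R}^3:\pm x>0\}$, then for almost every $\mathbf x=(x,z)\in\mathbb{R}^2$, $$\mathbb{A}(\mathbf x)=\mathbb{A}_p(\Theta\mathbf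 x),\qquad \rho(\mathbf x)=\rho_p(\Theta\mathbf x),\qquad \Theta:=\begin{pmatrix}1&0\\0&\theta_1\\0&\theta_2\end{pmatrix}.$$
   Context: A function on $\mathbb{R}^3$ is $\mathbb{Z}^3$-periodic if it is invariant under translations by all vectors of $\mathbb{Z}^3$. Note $\Theta\mathbf x=(x,\theta_1z,\theta_2z)$. *)

(* Defs.v *)
From mathcomp Require Import all_boot all_order all_algebra.
From mathcomp Require Import all_classical all_reals all_analysis.
Import Order.TTheory GRing.Theory Num.Theory numFieldNormedType.Exports.

Set Implicit Arguments.
Unset Strict Implicit.
Unset Printing Implicit Defensive.

Local Open Scope ring_scope.

                                                                             
                                                           

Definition vec2 (R : realType) (x z : R) : 'cV[R]_2 :=
  \col_(i < 2) [:: x; z]`_i.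

Definition ex (R : realType) : 'cV[R]_2 := vec2 1 0.
Definition ez (R : realType) : 'cV[R]_2 := vec2 0 1.
Arguments ex {R}.
Arguments ez {R}.

Definition xcoord (R : realType) (n : nat) (X : 'cV[R]_n.+1) : R :=
  X ord0 ord0.

                                                                          
                                                
Definition glued (R : realType) (n : nat) (T : Type)
    (fp fm f : 'cV[R]_n.+1 -> T) : Prop :=
  (forall X, 0 < xcoord X -> f X = fp X) /\
  (forall X, xcoord X < 0 -> f X = fm X).

Definition invariant_by (R : realType) (n : nat) (T : Type)
    (f : 'cV[R]_n -> T) (p : 'cV[R]_n) : Prop :=
  forall X, f (X + p) = f X.

Definition Zperiodic (R : realType) (n : nat) (T : Type)
    (f : 'cV[R]_n -> T) : Prop :=
  forall k : 'cV[int]_n, invariant_by f (map_mx intr k).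

Definition Theta (R : realType) (theta1 theta2 : R) : 'M[R]_(3, 2) :=
  \matrix_(i < 3, j < 2)
    (nth [::] [:: [:: 1; 0]; [:: 0; theta1]; [:: 0; theta2]] i)`_j.

Definition configA (R : realType)
    (Ap Am : 'cV[R]_2 -> 'M[R]_2) (rhop rhom : 'cV[R]_2 -> R)
    (theta1 theta2 : R) : Prop :=
  exists pzp pzm : R,
    [/\ 0 < pzp /\ 0 < pzm,
        invariant_by Ap ex /\ invariant_by Ap (pzp *: ez),
        invariant_by rhop ex /\ invariant_by rhop (pzp *: ez),
        invariant_by Am ex /\ invariant_by Am (pzm *: ez) &
        invariant_by rhom ex /\ invariant_by rhom (pzm *: ez)] /\
    theta1 = 1 / pzp /\ theta2 = 1 / pzm.

Definition configB (R : realType)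
    (Ap Am : 'cV[R]_2 -> 'M[R]_2) (rhop rhom : 'cV[R]_2 -> R)
    (theta1 theta2 : R) : Prop :=
  (exists c : 'M[R]_2, forall X, Am X = c) /\
  (exists c : R, forall X, rhom X = c) /\
  exists ppx ppz : R,
    [/\ ppz != 0,
        invariant_by Ap ex /\ invariant_by Ap (vec2 ppx ppz) &
        invariant_by rhop ex /\ invariant_by rhop (vec2 ppx ppz)] /\
    theta1 = 1 / ppz /\ theta2 = - ppx / ppz.

                                              
Definition lebesgue2 (R : realType) :=
  (@lebesgue_measure R \x @lebesgue_measure R)%E.

(* Main.v *)
Require Import Defs.
From mathcomp Require Import all_boot all_order all_algebra.
From mathcomp Require Import all_classical all_reals all_analysis.
Import Order.TTheory GRing.Theory Num.Theory numFieldNormedType.Exports.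
Local Open Scope ring_scope.

(** A function that is invariant under n vectors, the columns of a matrix L,
    becomes a Z^n-periodic function of n variables after composition with L;
    the composite is continuous if the function is ([Zperiodic_mulmx],
    [mulmx_continuous]).  If moreover L *m Theta = 1, then composing with Theta
    gives the original function back.  So it is enough to find, on each side
    of the interface, a 2 x 3 left inverse of Theta whose columns are periods
    of the coefficients.  Its columns can be
    - in configuration (A), (e_x, p_z^+ e_z, 0) on the right and
      (e_x, 0, p_z^- e_z) on the left;
    - in configuration (B), (e_x, p^+, e_x) on both sides, since every vector
      is a period of a constant.
    Theta preserves the first coordinate, so the two glued functions agree
    wherever x != 0 ([glued_pullback]); the line x = 0 is negligible. *)

(** * Periods of functions of a column vector *)

Lemma invariant_by0 (R : realType) (n : nat) (T : Type) (f : 'cV[R]_n -> T) :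
  invariant_by f 0.
Proof. by move=> X; rewrite addr0. Qed.

Lemma invariant_byD (R : realType) (n : nat) (T : Type) (f : 'cV[R]_n -> T)
    (p q : 'cV[R]_n) :
  invariant_by f p -> invariant_by f q -> invariant_by f (p + q).
Proof. by move=> fp fq X; rewrite addrA fq fp. Qed.

Lemma invariant_byN (R : realType) (n : nat) (T : Type) (f : 'cV[R]_n -> T)
    (p : 'cV[R]_n) :
  invariant_by f p -> invariant_by f (- p).
Proof. by move=> fp X; rewrite -[LHS]fp subrK. Qed.

Lemma invariant_by_intZ (R : realType) (n : nat) (T : Type)
    (f : 'cV[R]_n -> T) (p : 'cV[R]_n) (k : int) :
  invariant_by f p -> invariant_by f (k%:~R *: p).
Proof.
move=> fp; have fpn j : invariant_by f (p *+ j).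
  elim: j => [|j IH]; first exact: invariant_by0.
  by rewrite mulrS; exact: invariant_byD.
rewrite scaler_int; case: k => j; first exact: fpn.
by rewrite NegzE mulrNz; apply: invariant_byN; exact: fpn.
Qed.

(** * Pulling back by a matrix *)

Lemma mulmx_sum_col (R : realType) (m n : nat) (L : 'M[R]_(m, n))
    (X : 'cV[R]_n) :
  L *m X = \sum_j X j ord0 *: col j L.
Proof.
apply/matrixP => i k; rewrite mxE summxE.
by apply: eq_bigr => j _; rewrite !mxE (ord1 k) mulrC.
Qed.

Lemma mulmx_continuous (R : realType) (m n : nat) (L : 'M[R]_(m, n)) :
  continuous (fun X : 'cV[R]_n => L *m X).
Proof.
rewrite (funext (mulmx_sum_col R m n L)).
apply: continuous_big => [|j _ X]; first exact: add_continuous.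
by apply: continuousZr_tmp; exact: coord_continuous.
Qed.

(** An integer combination of the columns of L is an integer combination of
    periods of f, hence a period of f. *)
Lemma Zperiodic_mulmx (R : realType) (m n : nat) (T : Type)
    (f : 'cV[R]_n -> T) (L : 'M[R]_(n, m)) :
  (forall j, invariant_by f (col j L)) -> Zperiodic (fun X => f (L *m X)).
Proof.
move=> fL k X; rewrite mulmxDr [L *m map_mx _ _]mulmx_sum_col.
apply: (big_ind (invariant_by f)) => [||j _].
- exact: invariant_by0.
- exact: invariant_byD.
- by rewrite mxE; exact: invariant_by_intZ.
Qed.

(** M maps each half-space into the half-space of the same sign, so the side
    chosen for g at M *m X is the side chosen for f at X. *)
Lemma glued_pullback {R : realType} {m n : nat} {T : Type}
    {fp fm f : 'cV[R]_n.+1 -> T} {g : 'cV[R]_m.+1 -> T}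
    {M : 'M[R]_(m.+1, n.+1)} {Lp Lm : 'M[R]_(n.+1, m.+1)} :
  Lp *m M = 1%:M -> Lm *m M = 1%:M ->
  (forall X, xcoord (M *m X) = xcoord X) ->
  glued fp fm f ->
  glued (fun Y => fp (Lp *m Y)) (fun Y => fm (Lm *m Y)) g ->
  forall X, xcoord X != 0 -> f X = g (M *m X).
Proof.
move=> LpM LmM Mx [fpE fmE] [gpE gmE] X; rewrite neq_lt => /orP[X0|X0].
- by rewrite fmE// gmE ?Mx// mulmxA LmM mul1mx.
- by rewrite fpE// gpE ?Mx// mulmxA LpM mul1mx.
Qed.

(** * Left inverses of Theta *)

Definition columns (R : realType) (u v w : 'cV[R]_2) : 'M[R]_(2, 3) :=
  \matrix_(i, j) ([:: u; v; w]`_j) i ord0.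

Lemma invariant_by_columns (R : realType) (T : Type) (f : 'cV[R]_2 -> T)
    (u v w : 'cV[R]_2) :
  invariant_by f u -> invariant_by f v -> invariant_by f w ->
  forall j, invariant_by f (col j (columns R u v w)).
Proof.
move=> fu fv fw j; suff -> : col j (columns R u v w) = [:: u; v; w]`_j.
  by case: j => [[|[|[|j]]]].
by apply/matrixP => i k; rewrite !mxE (ord1 k).
Qed.

(** The columns of the product are e_x and theta1 v + theta2 w. *)
Lemma columns_mul_Theta (R : realType) (theta1 theta2 : R) (v w : 'cV[R]_2) :
  theta1 *: v + theta2 *: w = ez ->
  columns R ex v w *m Theta theta1 theta2 = 1%:M.
Proof.
move=> vwE; apply/matrixP => i j; rewrite mxE !big_ord_recl big_ord0 !mxE /=.
case: j => [[|[|j]]] //= ltj.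
- by rewrite !mulr0 !addr0 mulr1; case: i => [[|[|i]]].
- rewrite mulr0 add0r addr0 mulrC (mulrC (w _ _)).
  have /matrixP/(_ i ord0) := vwE; rewrite !mxE => ->.
  by case: i => [[|[|i]]].
Qed.

Lemma xcoord_Theta (R : realType) (theta1 theta2 : R) (X : 'cV[R]_2) :
  xcoord (Theta theta1 theta2 *m X) = xcoord X.
Proof.
rewrite /xcoord mxE !big_ord_recl big_ord0 !mxE /=.
by rewrite mul1r mul0r !addr0.
Qed.

(** * The interface is negligible *)

Lemma ae_off_interface (R : realType) (P : R * R -> Prop) :
  (forall p, p.1 != 0 -> P p) -> {ae @lebesgue2 R, forall p : R * R, P p}.
Proof.
move=> offP; exists ([set 0] `*` setT)%classic; split.
- exact: measurableX.
- rewrite /lebesgue2 product_measure1E//.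
  by rewrite [X in (X * _)%E]lebesgue_measure_set1 mul0e.
- move=> p /= nP; split=> //=.
  by have [//|/offP] := eqVneq p.1 0.
Qed.

(** * Existence of the periodic lifts *)

Theorem mainTheorem1 (R : realType)
  (Ap Am : 'cV[R]_2 -> 'M[R]_2) (rhop rhom : 'cV[R]_2 -> R)
  (A : 'cV[R]_2 -> 'M[R]_2) (rho : 'cV[R]_2 -> R)
  (theta1 theta2 : R)
  (cAp : continuous Ap) (cAm : continuous Am)
  (crhop : continuous rhop) (crhom : continuous rhom)
  (gA : glued Ap Am A) (grho : glued rhop rhom rho)
  (config : configA Ap Am rhop rhom theta1 theta2 \/
            configB Ap Am rhop rhom theta1 theta2) :
  exists (Aperp Aperm : 'cV[R]_3 -> 'M[R]_2) (rhoperp rhoperm : 'cV[R]_3 -> R),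
    [/\ continuous Aperp /\ Zperiodic Aperp,
        continuous Aperm /\ Zperiodic Aperm,
        continuous rhoperp /\ Zperiodic rhoperp,
        continuous rhoperm /\ Zperiodic rhoperm &
        forall (Aper : 'cV[R]_3 -> 'M[R]_2) (rhoper : 'cV[R]_3 -> R),
          glued Aperp Aperm Aper -> glued rhoperp rhoperm rhoper ->
          {ae @lebesgue2 R, forall p : R * R,
             A (vec2 p.1 p.2) = Aper (Theta theta1 theta2 *m vec2 p.1 p.2) /\
             rho (vec2 p.1 p.2) =
               rhoper (Theta theta1 theta2 *m vec2 p.1 p.2)}].
Proof.
have [[Lp [LpTheta LpA Lprho]] [Lm [LmTheta LmA Lmrho]]] :
    (exists L, [/\ L *m Theta theta1 theta2 = 1%:M,
       forall j, invariant_by Ap (col j L) &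
       forall j, invariant_by rhop (col j L)]) /\
    (exists L, [/\ L *m Theta theta1 theta2 = 1%:M,
       forall j, invariant_by Am (col j L) &
       forall j, invariant_by rhom (col j L)]).
  case: config => [[pzp [pzm [[[pzp0 pzm0] [? ?] [? ?] [? ?] [? ?]] [-> ->]]]]|].
    split.
      exists (columns R ex (pzp *: ez) 0); split.
      - apply: columns_mul_Theta.
        by rewrite scaler0 addr0 scalerA divfK ?scale1r ?gt_eqF.
      - by apply: invariant_by_columns => //; exact: invariant_by0.
      - by apply: invariant_by_columns => //; exact: invariant_by0.
    exists (columns R ex 0 (pzm *: ez)); split.
    - apply: columns_mul_Theta.
      by rewrite scaler0 add0r scalerA divfK ?scale1r ?gt_eqF.
    - by apply: invariant_by_columns => //; exact: invariant_by0.
    - by apply: invariant_by_columns => //; exact: invariant_by0.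
  case=> -[c AmE] [[d rhomE] [px [pz [[pz0 [? ?] [? ?]] [-> ->]]]]].
  have LTheta : columns R ex (vec2 px pz) ex *m Theta (1 / pz) (- px / pz)
      = 1%:M.
    apply: columns_mul_Theta; apply/matrixP => -[[|[|i]] lti] j //;
      rewrite !mxE /=.
    - by rewrite mulr1 mul1r mulNr (mulrC px) subrr.
    - by rewrite mulr0 addr0 divfK.
  split; exists (columns R ex (vec2 px pz) ex); split=> //.
  - exact: invariant_by_columns.
  - exact: invariant_by_columns.
  - by move=> j X; rewrite !AmE.
  - by move=> j X; rewrite !rhomE.
have cont (T : topologicalType) (f : 'cV[R]_2 -> T) (L : 'M[R]_(2, 3)) :
    continuous f -> continuous (fun X : 'cV[R]_3 => f (L *m X)).
  move=> cf X; apply: continuous_comp; first exact: mulmx_continuous.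
  exact: cf.
exists (fun X => Ap (Lp *m X)), (fun X => Am (Lm *m X)).
exists (fun X => rhop (Lp *m X)), (fun X => rhom (Lm *m X)).
split; try by split; [exact: cont | exact: Zperiodic_mulmx].
move=> Aper rhoper gAper grhoper.
apply: ae_off_interface => -[x z] /= x0.
have X0 : xcoord (vec2 x z) != 0 by rewrite /xcoord mxE.
have Mx := @xcoord_Theta R theta1 theta2.
by split; [exact: (glued_pullback LpTheta LmTheta Mx gA gAper _ X0)
         | exact: (glued_pullback LpTheta LmTheta Mx grho grhoper _ X0)].
Qed.
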